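(* Let $p\in\mathbb{N}$ (with $0\in\mathbb{N}$) and $\nu\in[0,1]$. For every finite simplicial complex $K$ and every subcomplex $L$ of $K$, $$0\leq M_{p,\nu}(L)-\mathbb{E}_\nu(b_p(L_0^\epsilon))\leq M_{p,\nu}(K)-\mathbb{E}_\nu(b_p(K_0^\epsilon)).$$
   Context: For a finite simplicial complex $K$, $f_i(K)$ is the number of $i$-simplices of $K$, $b_i(K)=\dim H_i(K;\mathbb{Z}/2\mathbb{Z})$, and $$M_{p,\nu}(K)=(\nu^{p+1}+(1-\nu)^{p+1})\,b_p(K)+\nu(1-\nu)(\nu^p+(1-\nu)^p)\sum_{i=p+1}^{\dim K}(-1)^{i+1-p}(f_i(K)-b_i(K)),$$ where the sum vanishes if $p\geq\dim K$. For $\epsilon\in C^0(K;\mathbb{Z}/2\mathbb{Z})$ (a $\mathbb{Z}/2\mathbb{Z}$-valued function on the vertices of $K$), $K_0^\epsilon$ is the subcomplex of $K$ consisting of the simplices on whose vertices $\epsilon$ is constant. $\mathbb{E}_\nu(b_p(K_0^\epsilon))$ is the expectation of $b_p(K_0^\epsilon)$ when the values of $\epsilon$ at the vertices of $K$ are independent, each being $0$ with probability $\nu$ and $1$ with probability $1-\nu$. The same notation applies to $L$ in place of $K$. *)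

(* Defs.v *)
From mathcomp Require Import all_boot all_order all_algebra mxrepresentation.
From mathcomp Require Import reals.

Set Implicit Arguments.
Unset Strict Implicit.
Unset Printing Implicit Defensive.

Import Order.TTheory GRing.Theory Num.Theory.
Local Open Scope ring_scope.

(* A simplex is identified with its set of vertices, an i-simplex being a set *)
(* of i.+1 vertices. The ambient type T may have elements that are not        *)
(* vertices of K: only those v with [set v] \in K are.                        *)
Definition simplicial_complex (T : finType) (K : {set {set T}}) : bool :=
  (set0 \notin K) &&
  [forall s in K, forall t : {set T}, (t != set0) && (t \subset s) ==> (t \in K)].

Definition subcomplex (T : finType) (L K : {set {set T}}) : bool :=
  simplicial_complex L && (L \subset K).

Section Complex.
Variables (T : finType) (K : {set {set T}}).

Definition vertex := {v : T | [set v] \in K}.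

(* Indexed by the number of vertices, i.e. the dimension plus one, so that    *)
(* degree -1 is available; simplices_card 0 is empty as set0 \notin K.        *)
Definition simplices_card (k : nat) : {set {set T}} := [set s in K | #|s| == k].

Definition face_number (i : nat) : nat := #|simplices_card i.+1|.

(* This is 0 instead of -1 for the empty complex.                             *)
Definition dim_complex : nat := \max_(s in K) #|s|.-1.

(* The boundary operator from i-chains to (i-1)-chains with coefficients in   *)
(* Z/2Z, acting on the right of row vectors. As simplices_card 0 is empty,    *)
(* boundary 0 is the zero map to the zero space (homology is not reduced).    *)
Definition boundary (i : nat) :
    'M['F_2]_(#|simplices_card i.+1|, #|simplices_card i|) :=
  \matrix_(s < #|simplices_card i.+1|, t < #|simplices_card i|)
    (enum_val t \subset enum_val s)%:R.

Definition cycles (i : nat) : 'M['F_2]_#|simplices_card i.+1| :=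
  kermx (boundary i).

Definition boundaries (i : nat) : 'M['F_2]_#|simplices_card i.+1| :=
  <<boundary i.+1>>%MS.

(* in_factmod U W spans the image of the row space of W in the quotient of    *)
(* the ambient space by the row space of U, here H_i = Z_i / B_i.             *)
Definition betti (i : nat) : nat := \rank (in_factmod (boundaries i) (cycles i)).

Definition cochain0 := {ffun vertex -> 'F_2}.

Definition mono_subcomplex (eps : cochain0) : {set {set T}} :=
  [set s in K | [forall u : vertex, forall v : vertex,
     (val u \in s) && (val v \in s) ==> (eps u == eps v)]].

Variables (R : realType) (nu : R).

Definition cochain0_prob (eps : cochain0) : R :=
  \prod_(v : vertex) (if eps v == 0 then nu else 1 - nu).

Definition expectation (X : cochain0 -> R) : R :=
  \sum_(eps : cochain0) cochain0_prob eps * X eps.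

Definition morse_bound (p : nat) : R :=
  (nu ^+ p.+1 + (1 - nu) ^+ p.+1) * (betti p)%:R
  + nu * (1 - nu) * (nu ^+ p + (1 - nu) ^+ p) *
    \sum_(p.+1 <= i < dim_complex.+1)
       (-1) ^+ (i + 1 - p)%N * ((face_number i)%:R - (betti i)%:R).

End Complex.

Definition expected_betti (T : finType) (R : realType) (nu : R) (p : nat)
    (K : {set {set T}}) : R :=
  expectation nu (fun eps : cochain0 K => (betti (mono_subcomplex eps) p)%:R).

Section Facts.
Variables (T : finType) (K : {set {set T}}).
Hypothesis complexK : simplicial_complex K.

Lemma face_in (s t : {set T}) :
  s \in K -> t != set0 -> t \subset s -> t \in K.
Proof.
move: complexK => /andP[_ /forall_inP cK] sK t0 ts.
by move: (cK s sK) => /forallP/(_ t); rewrite t0 ts.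
Qed.

Lemma boundary_boundary i : boundary K i.+1 *m boundary K i = 0.
Proof.
apply/matrixP => s u; rewrite !mxE.
under eq_bigr do rewrite !mxE -natrM mulnb.
have /setIdP[sK /eqP cs] := enum_valP s; have /setIdP[uK /eqP cu] := enum_valP u.
move: (enum_val s) (enum_val u) sK cs uK cu => S U SK cS UK cU.
have U0 : U != set0 by apply: contraTneq UK => ->; case/andP: complexK.
rewrite -(big_enum_val (fun t : {set T} => ((t \subset S) && (U \subset t))%:R : 'F_2)).
rewrite -natr_sum -big_mkcondr sum1_card.
have [US|nUS] := boolP (U \subset S); last first.
  rewrite (eq_card0 (A := _)) // => t; rewrite !inE.
  by apply: contraNF nUS => /and3P[_ tS Ut]; apply: subset_trans tS.
have -> : #|[pred t in simplices_card K i.+1 | (t \subset S) && (U \subset t)]|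
        = #|[set x |: U | x in S :\: U]|.
  apply: eq_card => t; rewrite !inE; apply/idP/imsetP.
    case/and3P => /andP[tK /eqP ct] tS Ut.
    have /eqP/cards1P[x xE] : #|t :\: U| = 1%N.
      by rewrite cardsD (setIidPr Ut) ct cU subSnn.
    have : x \in t :\: U by rewrite xE set11.
    rewrite inE => /andP[xU xt]; exists x; first by rewrite inE xU (subsetP tS).
    by rewrite -(setID t U) (setIidPr Ut) xE setUC.
  case=> x /setDP[xS xU] ->.
  have xUS : x |: U \subset S by rewrite subUset sub1set xS.
  rewrite xUS subsetUr cardsU1 xU cU eqxx !andbT (face_in SK) //.
  by apply/set0Pn; exists x; rewrite setU11.
rewrite card_in_imset.
  rewrite cardsD (setIidPr US) cS cU subSn ?subSnn ?leqnSn //.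
  by apply/val_inj.
move=> x y /setDP[_ xU] _ /setP/(_ x).
by rewrite !inE eqxx (negPf xU) !orbF => /esym/eqP.
Qed.

Lemma bettiE i :
  betti K i = (\rank (kermx (boundary K i)) - \rank (boundary K i.+1))%N.
Proof.
have BZ : (boundaries K i <= cycles K i)%MS.
  by rewrite genmxE; apply/sub_kermxP; apply: boundary_boundary.
rewrite -(addnK (\rank (boundaries K i)) (betti K i)) mxrank_in_factmod.
by rewrite (addsmx_idPr BZ) genmxE.
Qed.
End Facts.

(* Main.v *)
Require Import Defs.
From mathcomp Require Import all_boot all_order all_algebra.
From mathcomp Require Import reals.
From mathcomp Require Import ring.

Set Implicit Arguments.
Unset Strict Implicit.
Unset Printing Implicit Defensive.

Import Order.TTheory GRing.Theory Num.Theory.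

Local Open Scope ring_scope.

(** Everything is expressed through the ranks r_q of the boundary maps. Since
    b_i = f_i - r_i - r_(i+1), the alternating sum in M_(p,nu) telescopes to
    r_(p+1) ([alternating_face_betti_sum]). Put a_k = nu^k + (1 - nu)^k, which
    for k > 0 is the probability that k given vertices get the same value.
    Then a_(k+2) = a_(k+1) - nu (1 - nu) a_k, so

      M_(p,nu)(K) = a_(p+1) (f_p - r_p) - a_(p+2) r_(p+1).

    On the other hand E f_p(K_0) = a_(p+1) f_p(K), hence ([morse_gapE])

      M_(p,nu)(K) - E b_p(K_0) = Phi_p(K) + Phi_(p+1)(K),
      where Phi_q(K) = E r_q(K_0) - a_(q+1) r_q(K).

    It remains to see that each Phi_q is monotone in K; it vanishes on the
    empty complex, so it is then also nonnegative. The number r_q(K) is the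
    rank of a set of vectors, the boundaries of the q-simplices of K. Add a
    q-simplex s to K. By submodularity of the rank ([span_rank_submodular]), s
    raises the rank of any smaller set, in particular of the boundaries of the
    simplices of K_0, at least as much as it raises r_q(K). As s belongs to
    K_0 with probability a_(q+1), the first term of Phi_q grows at least as
    much as the second one ([thinning_gapU1]).

    In order to compare K and L, the expectations over their vertex cochains
    are all rewritten as expectations over colorings of the ambient type
    ([expectation_colorings]). *)

(** * Rank of a random subset of a family of vectors *)

Section SpanRank.
Variables (F : fieldType) (n : nat) (I : finType) (d : I -> 'rV[F]_n).
Implicit Types (A B : {set I}) (x : I).

Definition span_rank A : nat := \rank (\sum_(i in A) <<d i>>)%MS.

Lemma span_rank0 : span_rank set0 = 0%N.
Proof. by rewrite /span_rank big_set0 mxrank0. Qed.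

Lemma span_rankU1 x A : x \notin A ->
  span_rank (x |: A) = (span_rank A + ~~ (d x <= \sum_(i in A) <<d i>>)%MS)%N.
Proof.
move=> xA; rewrite /span_rank big_setU1 //=.
set U := (\sum_(i in A) _)%MS.
have [xU|xU] /= := boolP (d x <= U)%MS.
  rewrite addn0; apply: eqmx_rank.
  by rewrite addsmxSr addsmx_sub genmxE xU submx_refl.
apply/eqP; rewrite eqn_leq; apply/andP; split.
  rewrite addnC (leq_trans (mxrank_adds_leqif _ _).1) // leq_add2r genmxE.
  exact: rank_leq_row.
rewrite addn1; apply: rank_ltmx; rewrite /ltmx addsmxSr /=.
by rewrite addsmx_sub genmxE (negPf xU).
Qed.

(** The larger a set, the less a new vector adds to its rank: a vector already
    in the span of [A] is also in the span of [B]. *)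
Lemma span_rank_submodular x A B : A \subset B -> x \notin B ->
  (span_rank (x |: B) + span_rank A <= span_rank (x |: A) + span_rank B)%N.
Proof.
move=> AB xB; have xA : x \notin A by apply: contra xB; apply: subsetP.
rewrite !span_rankU1 // addnAC [leqRHS]addnAC.
rewrite [(span_rank A + _)%N]addnC leq_add2l.
suff UAB : (\sum_(i in A) <<d i>> <= \sum_(i in B) <<d i>>)%MS.
  have [xUA|_] := boolP (d x <= \sum_(i in A) <<d i>>)%MS; last exact: leq_b1.
  by rewrite (submx_trans xUA UAB).
by apply/sumsmx_subP => i iA; rewrite (sumsmx_sup i) // (subsetP AB).
Qed.

Variables (R : realDomainType) (Omega : finType) (w : Omega -> R).
Variables (S : Omega -> {set I}) (a : R).
Hypothesis w_ge0 : forall o, 0 <= w o.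

(** [S] is a random subset of the index set, under the weights [w]; if it
    contained each index with probability [a] and the vectors were
    independent, this difference would be 0. *)
Definition thinning_gap A : R :=
  \sum_o w o * (span_rank (A :&: S o))%:R - a * (span_rank A)%:R.

(** When [S o] contains [x], adding [x] to [A] also adds it to the smaller set
    [A :&: S o], where it contributes at least as much rank as to [A]; this
    happens with probability [a], the coefficient of the subtracted rank. *)
Lemma thinning_gapU1 x A :
    x \notin A -> \sum_o w o * (x \in S o)%:R = a ->
  thinning_gap A <= thinning_gap (x |: A).
Proof.
move=> xA wx; rewrite /thinning_gap lerBlDr addrAC lerBrDr -wx.
rewrite ![(\sum_o w o * (x \in S o)%:R) * _]mulr_suml -!big_split /=.
apply: ler_sum => o _; rewrite -!mulrA -!mulrDr ler_wpM2l //.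
rewrite setIUl; have [xS|xS] := boolP (x \in S o).
  have -> : [set x] :&: S o = [set x] by apply/setIidPl; rewrite sub1set.
  rewrite !mul1r -!natrD ler_nat [leqLHS]addnC.
  exact: span_rank_submodular (subsetIl _ _) xA.
rewrite !mul0r !addr0 ler_nat.
suff -> : [set x] :&: S o = set0 by rewrite set0U.
by apply/setP => y; rewrite !inE; case: eqP => // ->; apply/negbTE.
Qed.

Lemma thinning_gapS A B :
    A \subset B -> (forall x, x \in B -> \sum_o w o * (x \in S o)%:R = a) ->
  thinning_gap A <= thinning_gap B.
Proof.
have [m] := ubnP #|B :\: A|; elim: m => // m IHm in A *.
rewrite ltnS => leBA AB wB.
have [/eqP|[x xBA]] := set_0Vmem (B :\: A).
  rewrite setD_eq0 => BA; suff -> : A = B by [].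
  by apply/eqP; rewrite eqEsubset AB.
have /setDP[xB xA] := xBA.
apply: le_trans (thinning_gapU1 xA (wB x xB)) _.
apply: IHm => //; last by rewrite subUset sub1set xB.
by move: leBA; rewrite (cardsD1 x) xBA setDDl setUC.
Qed.

End SpanRank.

(** * Boundary maps as families of vectors *)

Section BoundaryRank.
Variable T : finType.
Implicit Types (K : {set {set T}}) (s t : {set T}).

(** The boundary of a simplex in one space for all complexes on [T], so that
    boundaries in a complex and in its subcomplexes can be compared. The empty
    face is left out because homology is not reduced. *)
Definition facet_row s : 'rV['F_2]_#|{set T}| :=
  \row_j [&& enum_val j != set0, enum_val j \subset s
           & #|enum_val j|.+1 == #|s|]%:R.

(** Relabelling the columns by all subsets of [T] is an injective linear map
    [P], as [K] contains all the facets of its simplices. *)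
Lemma rank_boundary K i : simplicial_complex K ->
  \rank (boundary K i) = span_rank facet_row (simplices_card K i.+1).
Proof.
move=> cK.
pose P : 'M['F_2]_(#|simplices_card K i|, #|{set T}|) :=
  \matrix_(t, j) (enum_val t == enum_val j)%:R.
have freeP : row_free P.
  apply/row_freeP; exists P^T; apply/matrixP => t u; rewrite !mxE.
  rewrite (bigD1 (enum_rank (enum_val t))) //= !mxE enum_rankK eqxx mul1r.
  rewrite big1 ?addr0 => [|j jt]; last first.
    rewrite !mxE; case: eqP => [tj|]; last by rewrite mul0r.
    by rewrite tj enum_valK eqxx in jt.
  by rewrite eq_sym (inj_eq enum_val_inj).
have row_bdP k : row k (boundary K i *m P) = facet_row (enum_val k).
  apply/rowP => j; rewrite !mxE.
  have /setIdP[SK /eqP cS] := enum_valP k.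
  under eq_bigr do rewrite !mxE.
  move: (enum_val k) SK cS (enum_val j) => {k j}S SK cS u.
  have [/and3P[u0 uS /eqP cu]|nuS] := boolP [&& _, _ & _].
    have uK : u \in simplices_card K i.
      by rewrite inE (face_in cK SK) //= -eqSS cu cS.
    rewrite (bigD1 (enum_rank_in uK u)) //= enum_rankK_in // uS eqxx mulr1.
    rewrite big1 ?addr0 // => t tu.
    case: eqP => [tE|]; last by rewrite mulr0.
    by case/negP: tu; apply/eqP/enum_val_inj; rewrite enum_rankK_in.
  rewrite big1 // => t _.
  have [tS|] := boolP (enum_val t \subset S); last by rewrite mul0r.
  case: eqP => [tE|]; last by rewrite mulr0.
  have /setIdP[tK /eqP ct] := enum_valP t.
  case/and3P: nuS; rewrite -tE ct cS; split => //.
  by apply: contraTneq tK => ->; case/andP: cK.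
rewrite -(mxrankMfree _ freeP) /span_rank; apply: eqmx_rank; apply/andP; split.
  apply/row_subP => k; rewrite row_bdP.
  by apply: (sumsmx_sup (enum_val k)); rewrite ?genmxE ?enum_valP.
apply/sumsmx_subP => s sK; rewrite genmxE -(enum_rankK_in sK sK) -row_bdP.
exact: row_sub.
Qed.

End BoundaryRank.

(** * Betti numbers and boundary ranks *)

Section BettiNumbers.
Variables (T : finType) (R : pzRingType) (K : {set {set T}}).
Hypothesis complexK : simplicial_complex K.

Lemma betti_rank i :
  (betti K i)%:R = (face_number K i)%:R - (\rank (boundary K i))%:R
                   - (\rank (boundary K i.+1))%:R :> R.
Proof.
rewrite bettiE // natrB ?mxrank_ker ?natrB ?rank_leq_row //.
by rewrite -mxrank_ker mxrankS //; apply/sub_kermxP/boundary_boundary.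
Qed.

Lemma boundary_above_dim i :
  (dim_complex K < i)%N -> \rank (boundary K i) = 0%N.
Proof.
move=> Ki; apply/eqP; rewrite -leqn0 (leq_trans (rank_leq_row _)) // leqn0.
rewrite cards_eq0; apply: contraTT Ki => /set0Pn[s /setIdP[sK /eqP cs]].
by rewrite -leqNgt -[i]/(i.+1.-1) -cs; apply: leq_bigmax_cond.
Qed.

(** Each [face_number - betti] is the sum of two consecutive boundary ranks, so
    that only the first rank survives; the last one is above the dimension. *)
Lemma alternating_face_betti_sum p :
  \sum_(p.+1 <= i < (dim_complex K).+1)
     (-1) ^+ (i + 1 - p)%N * ((face_number K i)%:R - (betti K i)%:R)
  = (\rank (boundary K p.+1))%:R :> R.
Proof.
have [pd|dp] := leqP p (dim_complex K); last first.
  by rewrite big_geq ?boundary_above_dim // ltnW.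
pose u i : R := (-1) ^+ (i - p)%N * (\rank (boundary K i))%:R.
rewrite (telescope_sumr_eq u) // => [|i /andP[pi _]].
  by rewrite /u boundary_above_dim // mulr0 sub0r subSnn expr1 mulN1r opprK.
rewrite /u addn1 subSn ?(ltnW pi) // exprS mulN1r betti_rank.
by rewrite !opprD !opprK !addrA subrr add0r !mulNr mulrDr opprD addrC.
Qed.

End BettiNumbers.

(** * Random colorings of the ambient type *)

Lemma sum_F2 (V : nmodType) (g : 'F_2 -> V) : \sum_c g c = g 0 + g 1.
Proof. by rewrite big_ord_recl big_ord1; congr (_ + g _); apply/val_inj. Qed.

Section Colorings.
Variables (T : finType) (R : realType) (nu : R).
Implicit Types (f : {ffun T -> 'F_2}) (s : {set T}) (K L : {set {set T}}).

Definition color_prob (c : 'F_2) : R := if c == 0 then nu else 1 - nu.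

Definition coloring_prob f : R := \prod_v color_prob (f v).

Definition monochromatic f s : bool :=
  [forall u in s, forall v in s, f u == f v].

Definition mono_faces f K : {set {set T}} := [set s in K | monochromatic f s].

(** The values of a coloring are independent. *)
Lemma prob_family (F : T -> pred 'F_2) :
  \sum_(f in family F) coloring_prob f
  = \prod_v \sum_(c in F v) color_prob c.
Proof. by rewrite bigA_distr_big_dep. Qed.

Lemma color_prob_total : \sum_c color_prob c = 1.
Proof. by rewrite sum_F2 /color_prob /= addrC subrK. Qed.

(** As [s] is nonempty, a coloring constant on [s] is so for exactly one of the
    two colors, hence the sum over the colors. *)
Lemma prob_monochromatic s k : #|s| = k.+1 ->
  \sum_f coloring_prob f * (monochromatic f s)%:R
  = nu ^+ k.+1 + (1 - nu) ^+ k.+1.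
Proof.
move=> sk.
have [x xs] : exists x, x \in s by apply/set0Pn; rewrite -card_gt0 sk.
pose F (c : 'F_2) v := if v \in s then pred1 c else predT.
have prob_const c :
    \sum_(f in family (F c)) coloring_prob f = color_prob c ^+ k.+1.
  rewrite prob_family -sk -prodr_const [RHS]big_mkcond.
  apply: eq_bigr => v _; rewrite /F; case: ifP => _.
    by rewrite big_pred1_eq.
  exact: color_prob_total.
have -> : \sum_f coloring_prob f * (monochromatic f s)%:R
        = \sum_f \sum_c coloring_prob f * (f \in family (F c))%:R.
  apply: eq_bigr => f _; rewrite -mulr_sumr; congr (_ * _).
  rewrite (bigD1 (f x)) //= big1 ?addr0 => [|c cx]; last first.
    case: familyP => // /(_ x); rewrite /F xs inE => /eqP fx.
    by rewrite fx eqxx in cx.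
  congr (nat_of_bool _)%:R; apply/idP/familyP => [mf v|cf].
    rewrite /F; case: ifP => // vs.
    by move/forall_inP/(_ v vs)/forall_inP/(_ x xs): mf.
  apply/forall_inP => u us; apply/forall_inP => v vs.
  by move: (cf u) (cf v); rewrite /F us vs !inE => /eqP-> /eqP->.
rewrite exchange_big /=.
under eq_bigr => c _.
  under eq_bigr do rewrite mulr_natr mulrb.
  rewrite -big_mkcond prob_const; over.
by rewrite sum_F2.
Qed.

Lemma mono_subcomplex_restrict K f : simplicial_complex K ->
  mono_subcomplex [ffun u : vertex K => f (val u)] = mono_faces f K.
Proof.
move=> cK; apply/setP => s; rewrite !inE; have [sK /=|//] := boolP (s \in K).
have vK v : v \in s -> [set v] \in K.
  move=> vs; apply: (face_in cK sK); last by rewrite sub1set.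
  by apply/set0Pn; exists v; rewrite set11.
apply/idP/forall_inP => [mf u us | mf].
  apply/forall_inP => v vs.
  move/forallP/(_ (exist _ u (vK u us)))/forallP/(_ (exist _ v (vK v vs))): mf.
  by rewrite /= us vs !ffunE.
apply/forallP => u; apply/forallP => v; apply/implyP => /andP[us vs].
by rewrite !ffunE; apply: (forall_inP (mf _ us)).
Qed.

(** The vertex cochain [eps] is the restriction of a random coloring: the values
    at the points of [T] that are not vertices of [K] sum out to 1. *)
Lemma expectation_colorings K (X : {set {set T}} -> R) : simplicial_complex K ->
  expectation nu (fun eps : cochain0 K => X (mono_subcomplex eps))
  = \sum_f coloring_prob f * X (mono_faces f K).
Proof.
move=> cK; pose restr f : cochain0 K := [ffun u => f (val u)].
rewrite (partition_big restr predT) //=; apply: eq_bigr => eps _.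
transitivity ((\sum_(f | restr f == eps) coloring_prob f)
              * X (mono_subcomplex eps)).
  congr (_ * _).
  (* The colorings that extend eps form a family: non-vertices are free. *)
  pose F v : pred 'F_2 := if insub v is Some u then pred1 (eps u) else predT.
  rewrite (eq_bigl (mem (family F))) => [|f]; last first.
    apply/eqP/familyP => [reps v|fF].
      by rewrite /F; case: insubP => // u _ <-; rewrite -reps inE ffunE.
    apply/ffunP => u; rewrite ffunE; move: (fF (val u)).
    by rewrite /F valK inE => /eqP.
  rewrite prob_family (bigID (fun v => [set v] \in K)) /=.
  rewrite [X in _ * X]big1 ?mulr1 => [|v vK]; last first.
    by rewrite /F insubF ?color_prob_total //; apply/negbTE.
  rewrite [RHS](reindex_omap (val : vertex K -> T) insub) => [|v vK].
    apply: eq_big => [u|u _]; first by rewrite valK eqxx (valP u).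
    by rewrite /F valK big_pred1_eq.
  by rewrite insubT.
rewrite mulr_suml; apply: eq_bigr => f /eqP <-.
by rewrite mono_subcomplex_restrict.
Qed.

Lemma mono_faces_complex f K :
  simplicial_complex K -> simplicial_complex (mono_faces f K).
Proof.
move=> cK; apply/andP; split.
  by rewrite inE negb_and; case/andP: cK => ->.
apply/forall_inP => s /setIdP[sK ms]; apply/forallP => t; apply/implyP.
case/andP=> t0 ts; rewrite inE (face_in cK sK) //=.
apply/forall_inP => u /(subsetP ts)/(forall_inP ms) mu.
by apply/forall_inP => v /(subsetP ts)/(forall_inP mu).
Qed.

Lemma simplices_mono_faces f K k :
  simplices_card (mono_faces f K) k
  = simplices_card K k :&: [set s | monochromatic f s].
Proof. by apply/setP => s; rewrite !inE andbAC. Qed.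

(** * The gap between the Morse bound and the expected Betti number *)

Hypothesis nu01 : 0 <= nu <= 1.

Lemma coloring_prob_ge0 f : 0 <= coloring_prob f.
Proof.
case/andP: nu01 => nu0 nu1; apply: prodr_ge0 => v _; rewrite /color_prob.
by case: ifP; rewrite ?subr_ge0.
Qed.

(** Phi_q: the expectation of r_q over the monochromatic subcomplexes of [K],
    minus its value on [K] times the probability that a q-simplex is
    monochromatic; see [boundary_rank_gapE]. *)
Definition boundary_rank_gap q K : R :=
  thinning_gap (@facet_row T) coloring_prob
    (fun f => [set s | monochromatic f s])
    (nu ^+ q.+1 + (1 - nu) ^+ q.+1) (simplices_card K q.+1).

Lemma boundary_rank_gapS q K L :
  L \subset K -> boundary_rank_gap q L <= boundary_rank_gap q K.
Proof.
move=> LK; apply: thinning_gapS => [f||s /setIdP[_ /eqP cs]].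
- exact: coloring_prob_ge0.
- by apply/subsetP => s; rewrite !inE => /andP[/(subsetP LK)-> ->].
- by under eq_bigr do rewrite inE; apply: prob_monochromatic.
Qed.

Lemma boundary_rank_gap0 q : boundary_rank_gap q set0 = 0.
Proof.
rewrite /boundary_rank_gap /thinning_gap.
have -> : simplices_card set0 q.+1 = set0 :> {set {set T}}.
  by apply/setP => s; rewrite !inE.
rewrite span_rank0 mulr0 subr0 big1 // => f _.
by rewrite set0I span_rank0 mulr0.
Qed.

Lemma boundary_rank_gap_ge0 q K : 0 <= boundary_rank_gap q K.
Proof. by rewrite -(boundary_rank_gap0 q) boundary_rank_gapS ?sub0set. Qed.

(** The q-simplices of a monochromatic subcomplex are the monochromatic
    q-simplices, so both ranks are ranks of the same vectors. *)
Lemma boundary_rank_gapE q K : simplicial_complex K ->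
  boundary_rank_gap q K
  = \sum_f coloring_prob f * (\rank (boundary (mono_faces f K) q))%:R
    - (nu ^+ q.+1 + (1 - nu) ^+ q.+1) * (\rank (boundary K q))%:R.
Proof.
move=> cK; rewrite rank_boundary //; congr (_ - _); apply: eq_bigr => f _.
by rewrite rank_boundary ?simplices_mono_faces //; apply: mono_faces_complex.
Qed.

Lemma expected_face_number p K :
  \sum_f coloring_prob f * (face_number (mono_faces f K) p)%:R
  = (nu ^+ p.+1 + (1 - nu) ^+ p.+1) * (face_number K p)%:R.
Proof.
transitivity (\sum_(s in simplices_card K p.+1) \sum_f
    coloring_prob f * (monochromatic f s)%:R).
  rewrite exchange_big; apply: eq_bigr => f _; rewrite -mulr_sumr.
  congr (_ * _); rewrite /face_number simplices_mono_faces.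
  rewrite -natr_sum -big_mkcondr sum1_card.
  congr _%:R; apply: eq_card => s.
  by rewrite [RHS]unfold_in !inE.
rewrite (eq_bigr (fun=> nu ^+ p.+1 + (1 - nu) ^+ p.+1)) => [|s].
  by rewrite sumr_const mulr_natr.
by case/setIdP => _ /eqP/prob_monochromatic.
Qed.

(** After all terms are written in f_p, r_p and r_(p+1), the two sides agree by
    the recurrence a_(p+2) = a_(p+1) - nu (1 - nu) a_p, with a_k the sum of
    the k-th powers of nu and 1 - nu. *)
Lemma morse_gapE p K : simplicial_complex K ->
  morse_bound K nu p - expected_betti nu p K
  = boundary_rank_gap p K + boundary_rank_gap p.+1 K.
Proof.
move=> cK; rewrite /expected_betti.
rewrite (expectation_colorings (fun J => (betti J p)%:R)) //.
under eq_bigr do rewrite betti_rank ?mono_faces_complex // !mulrBr.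
rewrite !sumrB expected_face_number !boundary_rank_gapE // /morse_bound.
rewrite alternating_face_betti_sum // betti_rank // !exprS.
ring.
Qed.

End Colorings.

Theorem theorem1p6 (R : realType) (p : nat) (nu : R) (hnu : 0 <= nu <= 1)
    (T : finType) (K L : {set {set T}})
    (hK : simplicial_complex K) (hL : subcomplex L K) :
  0 <= morse_bound L nu p - expected_betti nu p L
    <= morse_bound K nu p - expected_betti nu p K.
Proof.
have /andP[cL LK] := hL.
rewrite !morse_gapE //; apply/andP; split.
  by apply: addr_ge0; apply: boundary_rank_gap_ge0.
by apply: lerD; apply: boundary_rank_gapS.
Qed.
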